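(* Let $\mathcal{A}$ be a real symmetric tensor of order $m$ and dimension $n$. Then $\mathcal{A}$ is strictly copositive if and only if every principal sub-tensor of $\mathcal{A}$ has no non-positive $H^{++}$-eigenvalue, i.e., no principal sub-tensor of $\mathcal{A}$ has an eigenvector $v>0$ with associated $H$-eigenvalue $\lambda\le 0$.
   Context: Let $m,n$ be positive integers. A real tensor of order $m$ and dimension $n$ is an array $\mathcal{A}=(a_{i_1\cdots i_m})$ with $a_{i_1\cdots i_m}\in\mathbb{R}$, $1\le i_1,\dots,i_m\le n$. It is symmetric if its entries are invariant under every permutation of the indices. For $x\in\mathbb{R}^n$, $\mathcal{A}x^{m-1}\in\mathbb{R}^n$ is the vector with $i$-th component $\sum_{i_2,\dots,i_m=1}^n a_{ii_2\cdots i_m}x_{i_2}\cdots x_{i_m}$, and $\mathcal{A}x^m=x^T(\mathcal{A}x^{m-1})=\sum_{i_1,\dots,i_m=1}^n a_{i_1\cdots i_m}x_{i_1}\cdots x_{i_m}$. For a real vector $x$, $x\ge 0$ (resp. $x>0$) means all components are $\ge 0$ (resp. $>0$); $\mathbb{R}^n_+=\{x\in\mathbb{R}^n: x\ge 0\}$ and $\mathbb{R}^n_{++}=\{x\in\mathbb{R}^n: x>0\}$. $\mathcal{A}$ is strictly copositive if $\mathcal{A}x^m>0$ for all $x\in\mathbb{R}^n_+\setminus\{0\}$. For $1\le r\le n$ and a set $\mathcal{N}\subseteq\{1,\dots,n\}$ with $r$ elements, the array $\mathcal{B}=(a_{i_1\cdots i_m})_{i_1,\dots,i_m\in\mathcal{N}}$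 is an order $m$, dimension $r$ principal sub-tensor of $\mathcal{A}$ (the case $\mathcal{N}=\{1,\dots,n\}$, giving $\mathcal{A}$ itself, is included). For a tensor $\mathcal{B}$ of order $m$ and dimension $r$, a real number $\lambda$ is an $H$-eigenvalue with $H$-eigenvector $x\in\mathbb{R}^r\setminus\{0\}$ if $\mathcal{B}x^{m-1}=\lambda x^{[m-1]}$, where $x^{[m-1]}=(x_1^{m-1},\dots,x_r^{m-1})^T$. It is an $H^{++}$-eigenvalue of $\mathcal{B}$ if it has an $H$-eigenvector in $\mathbb{R}^r_{++}$. *)

(* Defs.v *)
From HB Require Import structures.
From mathcomp Require Import all_boot all_order all_algebra all_fingroup.
From mathcomp Require Import reals.

Set Implicit Arguments.
Unset Strict Implicit.
Unset Printing Implicit Defensive.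

Import Order.TTheory GRing.Theory Num.Theory.

Local Open Scope ring_scope.

(* Real tensors of order m and dimension n. Indices range over 'I_n, i.e. over
   {0, ..., n-1} instead of {1, ..., n}; the multi-index (i_1, ..., i_m) is an
   m-tuple. A positive order is written m.+1 where positivity matters. *)
Definition tensor (R : realType) (m n : nat) := {ffun m.-tuple 'I_n -> R}.

Section Tensors.
Variable R : realType.

Definition symmetric_tensor (m n : nat) (A : tensor R m n) : Prop :=
  forall (s : 'S_m) (t : m.-tuple 'I_n),
    A [tuple tnth t (s j) | j < m] = A t.

(* A x^m, a scalar *)
Definition tensor_form (m n : nat) (A : tensor R m n) (x : 'rV[R]_n) : R :=
  \sum_(t : m.-tuple 'I_n) A t * \prod_(j < m) x 0 (tnth t j).

(* A x^(m-1), a vector; here A has order m.+1, so this is A x^m in terms of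
   the argument m. *)
Definition tensor_apply (m n : nat) (A : tensor R m.+1 n) (x : 'rV[R]_n) :
    'rV[R]_n :=
  \row_(i < n) \sum_(t : m.-tuple 'I_n)
    A [tuple of i :: t] * \prod_(j < m) x 0 (tnth t j).

Lemma tensor_formE (m n : nat) (A : tensor R m.+1 n) (x : 'rV[R]_n) :
  tensor_form A x = \sum_(i < n) x 0 i * tensor_apply A x 0 i.
Proof.
rewrite /tensor_form.
under [RHS]eq_bigr => i _ do rewrite mxE mulr_sumr.
rewrite pair_big /=.
rewrite (reindex (fun p : 'I_n * m.-tuple 'I_n => [tuple of p.1 :: p.2])) /=.
  apply: eq_bigr => -[i t] _ /=; rewrite big_ord_recl tnth0 mulrCA.
  by congr (_ * (_ * _)); apply: eq_bigr => j _; rewrite tnthS.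
exists (fun t => (thead t, [tuple of behead t])) => [[i t] _ | t _] /=.
  by congr pair; apply: val_inj.
by rewrite [RHS]tuple_eta.
Qed.

Definition nonneg_vec (n : nat) (x : 'rV[R]_n) : Prop :=
  forall i, 0 <= x 0 i.

Definition pos_vec (n : nat) (x : 'rV[R]_n) : Prop :=
  forall i, 0 < x 0 i.

Definition strictly_copositive (m n : nat) (A : tensor R m n) : Prop :=
  forall x : 'rV[R]_n, nonneg_vec x -> x != 0 -> 0 < tensor_form A x.

(* The entries of A with all indices in N. The elements of N are renumbered as
   'I_#|N| by the increasing enumeration enum_val. *)
Definition principal_subtensor (m n : nat) (A : tensor R m n)
    (N : {set 'I_n}) : tensor R m #|N| :=
  [ffun t : m.-tuple 'I_#|N| =>
     A [tuple enum_val (A := mem N) (tnth t j) | j < m]].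

(* (lambda, x) is an H-eigenpair; in order m.+1 the exponent m-1 of the usual
   definition becomes m. *)
Definition H_eigenpair (m r : nat) (B : tensor R m.+1 r)
    (lambda : R) (x : 'rV[R]_r) : Prop :=
  x != 0 /\ tensor_apply B x = lambda *: map_mx (fun a => a ^+ m) x.

Definition Hpp_eigenvalue (m r : nat) (B : tensor R m.+1 r)
    (lambda : R) : Prop :=
  exists x : 'rV[R]_r, H_eigenpair B lambda x /\ pos_vec x.

End Tensors.

(* Main.v *)
(* An eigenvector v > 0 of a principal sub-tensor, extended by zero, is a
   nonnegative x with A x^m = lambda * sum_i x_i^m, so strict copositivity
   forces lambda > 0.  Conversely let lambda be the minimum of A x^m on the
   compact set {x >= 0, sum_i x_i^m = 1}, attained at x, and let N be the
   support of x.  By homogeneity A y^m - lambda * sum_i y_i^m >= 0 on the whole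
   orthant, with equality at x.  For i in N this stays true on x + s e_i
   for small s of either sign, so the s-derivative vanishes at 0; as A is
   symmetric, this says (A x^(m-1))_i = lambda x_i^(m-1).  Hence x restricted to
   N is a positive eigenvector of the sub-tensor on N, and lambda > 0 by
   hypothesis. *)
Require Import Defs.
From mathcomp Require Import all_boot all_order all_algebra.
From mathcomp Require Import all_fingroup reals.
From mathcomp Require Import topology normedtype derive realfun exp.

Set Implicit Arguments.
Unset Strict Implicit.
Unset Printing Implicit Defensive.

Import Order.TTheory GRing.Theory Num.Theory.
Import numFieldNormedType.Exports.
Local Open Scope ring_scope.

(** * Leibniz rule for finite products of polynomials *)

Section DerivProd.
Variables (R : comNzRingType) (I : eqType).

(** Induction with the binary product rule; uniqueness makes the filter [k != i] drop exactly one
    factor. *)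
Lemma deriv_prod_seq (r : seq I) (F : I -> {poly R}) : uniq r ->
  (\prod_(i <- r) F i)^`() =
  \sum_(i <- r) (F i)^`() * \prod_(k <- r | k != i) F k.
Proof.
elim: r => [_|a r IHr /= /andP[ar ur]].
  by rewrite !big_nil -polyC1 derivC.
rewrite !big_cons eqxx /= derivM IHr // mulr_sumr; congr (_ * _ + _).
  rewrite [RHS]big_seq_cond [LHS]big_seq; apply: eq_bigl => k.
  by case: (eqVneq k a) => [->|_]; rewrite ?(negPf ar) ?andbT.
rewrite !big_seq; apply: eq_bigr => i ir; rewrite big_cons.
have -> : a != i by apply: contraNneq ar => ->.
by rewrite mulrCA.
Qed.

End DerivProd.

Lemma deriv_prod (R : comNzRingType) (I : finType) (F : I -> {poly R}) :
  (\prod_i F i)^`() = \sum_i (F i)^`() * \prod_(k | k != i) F k.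
Proof. by rewrite deriv_prod_seq // index_enum_uniq. Qed.

(** * Homogeneity, continuity and symmetry of the form *)

Section TensorForm.
Variables (R : realType) (n : nat).

Lemma sum_tuple_cons (m : nat) (F : m.+1.-tuple 'I_n -> R) :
  \sum_t F t = \sum_i \sum_(t : m.-tuple 'I_n) F [tuple of i :: t].
Proof.
rewrite pair_big /=.
rewrite (reindex (fun p : 'I_n * m.-tuple 'I_n => [tuple of p.1 :: p.2])) //=.
exists (fun t => (thead t, [tuple of behead t])) => [[i t] _ | t _] /=.
  by congr pair; apply: val_inj.
by rewrite [RHS]tuple_eta.
Qed.

Lemma tensor_formZ (m : nat) (A : tensor R m n) (c : R) (x : 'rV[R]_n) :
  tensor_form A (c *: x) = c ^+ m * tensor_form A x.
Proof.
rewrite /tensor_form mulr_sumr; apply: eq_bigr => t _.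
under eq_bigr do rewrite mxE.
by rewrite big_split /= prodr_const card_ord mulrCA.
Qed.

Lemma tensor_form0 (m : nat) (A : tensor R m.+1 n) : tensor_form A 0 = 0.
Proof. by rewrite -(scale0r 0) tensor_formZ exprS !mul0r. Qed.

Lemma continuous_tensor_form (m : nat) (A : tensor R m n) :
  continuous (tensor_form A).
Proof.
apply: continuous_big => [|t _]; first exact: (@add_continuous R^o).
move=> x; apply: continuousM; first exact: cst_continuous.
apply: continuous_big => [|j _]; first exact: mul_continuous.
exact: coord_continuous.
Qed.

(** Symmetry lets the transposition of slots [0] and [j] move the marked index to the front. All
    slots thus contribute equally, which yields the factor [m.+1] in the derivative of the form. *)
Lemma sum_slot_tensor (m : nat) (A : tensor R m.+1 n) (x : 'rV[R]_n) i j :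
  symmetric_tensor A ->
  \sum_(t : m.+1.-tuple 'I_n)
    A t * ((tnth t j == i)%:R * \prod_(k | k != j) x 0 (tnth t k)) =
  tensor_apply A x 0 i.
Proof.
move=> symA; pose s := tperm ord0 j.
pose act (t : m.+1.-tuple 'I_n) := [tuple tnth t (s k) | k < m.+1].
have actK : involutive act.
  by move=> t; apply: eq_from_tnth => k; rewrite !tnth_mktuple tpermK.
rewrite (reindex_inj (inv_inj actK)) sum_tuple_cons mxE.
rewrite (bigD1 i) //= [X in _ + X]big1 ?addr0 => [|i' ii']; last first.
  apply: big1 => t _; rewrite tnth_mktuple tpermR tnth0 (negPf ii') mul0r.
  by rewrite mulr0.
apply: eq_bigr => t _; rewrite symA tnth_mktuple tpermR tnth0 eqxx mul1r.
congr (_ * _); rewrite (reindex_inj (@perm_inj _ s)) /=.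
under eq_bigr do rewrite tnth_mktuple tpermK.
rewrite big_mkcond big_ord_recl tpermL eqxx /= mul1r.
apply: eq_bigr => k _.
by rewrite -[X in _ != X](tpermL ord0 j) (inj_eq perm_inj) tnthS.
Qed.

End TensorForm.

(** * The form and the power sum along a coordinate direction *)

Section CoordinateLine.
Variables (R : realType) (n : nat) (x : 'rV[R]_n) (i : 'I_n).

(** A polynomial in the step [s], so that derivatives along the line can be computed formally. *)
Definition coord_line (k : 'I_n) : {poly R} :=
  (x 0 k)%:P + (k == i)%:R *: 'X.

Lemma coord_lineE k s :
  (coord_line k).[s] = (x + s *: delta_mx 0 i) 0 k.
Proof. by rewrite !hornerE !mxE eqxx /= mulrC. Qed.

Lemma coord_line0 k : (coord_line k).[0] = x 0 k.
Proof. by rewrite !hornerE. Qed.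

Lemma deriv_coord_line k : (coord_line k)^`() = (k == i)%:R%:P.
Proof. by rewrite derivD derivC add0r derivZ derivX alg_polyC. Qed.

Definition form_line (m : nat) (A : tensor R m n) : {poly R} :=
  \sum_(t : m.-tuple 'I_n) A t *: \prod_(j < m) coord_line (tnth t j).

Lemma form_lineE (m : nat) (A : tensor R m n) s :
  (form_line A).[s] = tensor_form A (x + s *: delta_mx 0 i).
Proof.
rewrite horner_sum; apply: eq_bigr => t _; rewrite hornerZ horner_prod.
by congr (_ * _); apply: eq_bigr => j _; rewrite coord_lineE.
Qed.

Lemma deriv_form_line (m : nat) (A : tensor R m.+1 n) :
  symmetric_tensor A ->
  (form_line A)^`().[0] = m.+1%:R * tensor_apply A x 0 i.
Proof.
move=> symA; rewrite /form_line raddf_sum /= horner_sum.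
under eq_bigr => t _.
  rewrite derivZ deriv_prod hornerZ horner_sum mulr_sumr.
  under eq_bigr => j _.
    rewrite hornerM horner_prod deriv_coord_line hornerC.
    under eq_bigr do rewrite coord_line0.
    over.
  over.
rewrite exchange_big /=.
under eq_bigr do rewrite sum_slot_tensor //.
by rewrite sumr_const card_ord mulr_natl.
Qed.

Definition power_line (m : nat) : {poly R} := \sum_k coord_line k ^+ m.

Lemma power_lineE (m : nat) s :
  (power_line m).[s] = \sum_k (x + s *: delta_mx 0 i) 0 k ^+ m.
Proof.
by rewrite horner_sum; apply: eq_bigr => k _; rewrite horner_exp coord_lineE.
Qed.

Lemma deriv_power_line (m : nat) :
  (power_line m.+1)^`().[0] = m.+1%:R * x 0 i ^+ m.
Proof.
rewrite /power_line raddf_sum /= horner_sum.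
rewrite (bigD1 i) //= big1 ?addr0 => [|k ki]; last first.
  by rewrite deriv_exp deriv_coord_line (negPf ki) mul0r mul0rn horner0.
rewrite deriv_exp deriv_coord_line eqxx mul1r hornerMn horner_exp coord_line0.
by rewrite mulr_natl.
Qed.

End CoordinateLine.

(** At an interior minimum the analytic derivative vanishes, and for polynomials it agrees with the
    formal one. *)
Lemma deriv_poly_min (R : realType) (p : {poly R}) (e : R) : 0 < e ->
  (forall s, - e < s < e -> p.[0] <= p.[s]) -> p^`().[0] = 0.
Proof.
move=> e0 pmin.
have dp0 : is_derive (0 : R) 1 (horner p) 0.
  apply: (@derive1_at_min _ _ (- e) e).
  - by rewrite (le_trans (ltW _) (ltW e0)) // oppr_lt0.
  - by move=> s _; exact: derivable_horner.
  - by rewrite in_itv /= oppr_lt0 e0.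
  - by move=> s; rewrite in_itv /=; exact: pmin.
by rewrite derivE derive1E derive_val.
Qed.

(** * Existence of a minimizer and its first-order condition *)

Section Minimizer.
Import classical_sets.
Variables (R : realType) (m n : nat) (A : tensor R m.+1 n).

Lemma stationary_min (lambda : R) (x : 'rV[R]_n) (i : 'I_n) :
  symmetric_tensor A -> nonneg_vec x -> 0 < x 0 i ->
  tensor_form A x = lambda * \sum_k x 0 k ^+ m.+1 ->
  (forall y, nonneg_vec y ->
     lambda * \sum_k y 0 k ^+ m.+1 <= tensor_form A y) ->
  tensor_apply A x 0 i = lambda * x 0 i ^+ m.
Proof.
move=> symA x0 xi0 fx fmin.
pose p := form_line x i A - lambda *: power_line x i m.+1.
have pE s : p.[s] = tensor_form A (x + s *: delta_mx 0 i) -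
    lambda * \sum_k (x + s *: delta_mx 0 i) 0 k ^+ m.+1.
  by rewrite !hornerE form_lineE power_lineE.
have : p^`().[0] = 0.
  (* The radius is [x 0 i] itself: for [s > - x 0 i] the shifted point stays in the orthant, where
     [p] is nonnegative, and [p] vanishes at 0. *)
  apply: (@deriv_poly_min _ p _ xi0) => s /andP[xs _].
  rewrite !pE scale0r addr0 fx subrr subr_ge0; apply: fmin => k.
  rewrite !mxE eqxx /=; case: eqP => [->|_] /=.
    by rewrite mulr1 -lerBlDl sub0r ltW.
  by rewrite mulr0 addr0.
rewrite derivB derivZ !hornerE deriv_form_line // deriv_power_line.
rewrite mulrCA -mulrBr => /eqP; rewrite mulf_eq0 pnatr_eq0 /= subr_eq0.
by move/eqP.
Qed.

Lemma power_sum_gt0 (y : 'rV[R]_n) : nonneg_vec y -> y != 0 ->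
  0 < \sum_k y 0 k ^+ m.+1.
Proof.
move=> y0 /rV0Pn[i yi]; rewrite (bigD1 i) //= ltr_wpDr //.
  by rewrite sumr_ge0 // => k _; rewrite exprn_ge0.
by rewrite exprn_gt0 // lt_neqAle eq_sym yi y0.
Qed.

Local Open Scope classical_set_scope.

Lemma exists_form_min : (0 < n)%N ->
  exists (lambda : R) (x : 'rV[R]_n),
    [/\ nonneg_vec x, x != 0,
        tensor_form A x = lambda * \sum_k x 0 k ^+ m.+1 &
        forall y, nonneg_vec y ->
          lambda * \sum_k y 0 k ^+ m.+1 <= tensor_form A y].
Proof.
move=> n0; pose p (y : 'rV[R]_n) : R := \sum_k y 0 k ^+ m.+1.
(* The box gives nonnegativity and compactness at once. Its upper bound excludes nothing, since
   nonnegative coordinates with power sum 1 are at most 1. *)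
pose K := [set y : 'rV[R]_n | forall i, `[0, 1] (y ord0 i)] `&`
          p @^-1` [set 1].
have K0 : K !=set0.
  exists (delta_mx 0 (Ordinal n0)); split => [i|] /=.
    by rewrite in_itv /= mxE ler0n lern1 leq_b1.
  rewrite /p (bigD1 (Ordinal n0)) //= mxE !eqxx expr1n big1 ?addr0 // => k kn.
  by rewrite mxE (negPf kn) andbF exprS mul0r.
have cp : continuous p.
  apply: continuous_big => [|k _]; first exact: (@add_continuous R^o).
  move=> y; apply: (@continuous_comp _ _ _ (fun z : 'rV[R]_n => z 0 k)
    (fun a => a ^+ m.+1)); first exact: coord_continuous.
  exact: exprn_continuous.
have cK : compact K.
  apply: compact_closedI.
    exact: rV_compact (fun=> @segment_compact _ _ _).
  by apply: preimage_closed; [move=> y _; exact: cp | exact: closed_eq].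
have [x /set_mem[Kx px] xmin] := compact_EVT_min K0 cK
  (continuous_subspaceT (@continuous_tensor_form _ _ _ A)).
have x0 : nonneg_vec x.
  by move=> i; have /= := Kx i; rewrite in_itv /= => /andP[].
exists (tensor_form A x), x; split => // [||y y0].
- apply: contra_eq_neq px => ->; rewrite /p big1 1?eq_sym ?oner_neq0 // => k _.
  by rewrite mxE exprS mul0r.
- by rewrite -/(p x) px mulr1.
(* The zero vector cannot be rescaled into [K]; there both sides are 0. *)
have [->|yN0] := eqVneq y 0.
  by rewrite tensor_form0 big1 ?mulr0 // => k _; rewrite mxE exprS mul0r.
have := power_sum_gt0 y0 yN0; rewrite -/(p y) => py0.
(* The root of order [m.+1] of the power sum, so that [y] divided by [r] lies in [K]; homogeneity
   then carries the bound back to [y]. *)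
pose r := p y `^ m.+1%:R^-1.
have r0 : 0 < r by rewrite powR_gt0.
have rX : r ^+ m.+1 = p y.
  by rewrite -powR_mulrn ?powR_ge0 // -powRrM mulVf ?pnatr_eq0 // powRr1 // ltW.
pose z := r^-1 *: y.
have z0 k : 0 <= z 0 k by rewrite mxE mulr_ge0 // invr_ge0 ltW.
have pz : p z = 1.
  rewrite /p; under eq_bigr do rewrite mxE exprMn.
  by rewrite -mulr_sumr exprVn rX mulVf // gt_eqF.
have : tensor_form A x <= tensor_form A z.
  apply/xmin/mem_set; split=> // k /=; rewrite in_itv /= z0 /=.
  rewrite -(@expr_le1 _ m.+1) // -pz /p (bigD1 k) //= lerDl sumr_ge0 // => l _.
  by rewrite exprn_ge0.
by rewrite tensor_formZ exprVn rX ler_pdivlMl // mulrC.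
Qed.

End Minimizer.

(** * Principal sub-tensors and vectors supported on an index set *)

Section PrincipalSubtensor.
Variables (R : realType) (n : nat) (N : {set 'I_n}).

Definition enum_tuple (m : nat) (t : m.-tuple 'I_#|N|) : m.-tuple 'I_n :=
  [tuple enum_val (A := mem N) (tnth t j) | j < m].

Definition restrict_vec (x : 'rV[R]_n) : 'rV[R]_#|N| :=
  \row_k x 0 (enum_val k).

Lemma enum_tuple_inj (m : nat) : injective (@enum_tuple m).
Proof.
move=> s t st; apply: eq_from_tnth => j; apply: enum_val_inj.
by have /(congr1 (fun u => tnth u j)) := st; rewrite !tnth_mktuple.
Qed.

Lemma mem_enum_tuple (m : nat) (t : m.-tuple 'I_n) :
  (t \in @enum_tuple m @: setT) = [forall j, tnth t j \in N].
Proof.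
apply/imsetP/forallP => [[s _ ->] j|tN].
  by rewrite tnth_mktuple enum_valP.
exists [tuple enum_rank_in (tN j) (tnth t j) | j < m] => //.
by apply: eq_from_tnth => j; rewrite !tnth_mktuple enum_rankK_in.
Qed.

(** A tuple with an index outside [N] contributes a zero factor; the remaining tuples are exactly
    the image of the injective [enum_tuple]. *)
Lemma sum_supported (m : nat) (F : m.-tuple 'I_n -> R) (x : 'rV[R]_n) :
  (forall i, i \notin N -> x 0 i = 0) ->
  \sum_(t : m.-tuple 'I_n) F t * \prod_(j < m) x 0 (tnth t j) =
  \sum_(t : m.-tuple 'I_#|N|)
    F (enum_tuple t) * \prod_(j < m) restrict_vec x 0 (tnth t j).
Proof.
move=> x0; rewrite (bigID [in @enum_tuple m @: setT]) /=.
rewrite [X in _ + X]big1 ?addr0; last first.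
  move=> t; rewrite mem_enum_tuple => /forallPn[j /x0 tj].
  by rewrite (bigD1 j) //= tj mul0r mulr0.
rewrite big_imset /=; last by move=> s t _ _; apply: enum_tuple_inj.
apply: eq_big => [t|t _]; first by rewrite in_setT.
by congr (_ * _); apply: eq_bigr => j _; rewrite tnth_mktuple mxE.
Qed.

Lemma tensor_form_subtensor (m : nat) (A : tensor R m n) (x : 'rV[R]_n) :
  (forall i, i \notin N -> x 0 i = 0) ->
  tensor_form (principal_subtensor A N) (restrict_vec x) = tensor_form A x.
Proof.
move=> x0; rewrite [RHS]sum_supported //.
by apply: eq_bigr => t _; rewrite ffunE.
Qed.

Lemma tensor_apply_subtensor (m : nat) (A : tensor R m.+1 n) (x : 'rV[R]_n) k :
  (forall i, i \notin N -> x 0 i = 0) ->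
  tensor_apply (principal_subtensor A N) (restrict_vec x) 0 k =
  tensor_apply A x 0 (enum_val k).
Proof.
move=> x0; rewrite !mxE [RHS]sum_supported //.
apply: eq_bigr => t _; rewrite ffunE; congr (A _ * _).
apply: eq_from_tnth => j; rewrite tnth_mktuple.
(* Slot 0 holds the free index [k], the other slots the summation tuple. *)
by case: (unliftP ord0 j) => [j' ->|->]; rewrite ?tnthS ?tnth0 ?tnth_mktuple.
Qed.

Lemma restrict_vec_surj (v : 'rV[R]_#|N|) :
  exists x : 'rV[R]_n, restrict_vec x = v /\ forall i, i \notin N -> x 0 i = 0.
Proof.
(* Extension by zero: the inner sum has one term if [i] lies in [N] and is empty otherwise. *)
exists (\row_i \sum_(k | enum_val k == i) v 0 k); split.
  apply/rowP => k; rewrite !mxE (bigD1 k) //= big1 ?addr0 // => l.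
  by rewrite (inj_eq enum_val_inj) => /andP[->].
move=> i iN; rewrite mxE big1 // => k /eqP ki.
by rewrite -ki enum_valP in iN.
Qed.

End PrincipalSubtensor.

(** * Eigenvectors and strict copositivity *)

Lemma tensor_form_eigen (R : realType) (m n : nat) (A : tensor R m.+1 n)
    (lambda : R) (x : 'rV[R]_n) :
  H_eigenpair A lambda x ->
  tensor_form A x = lambda * \sum_k x 0 k ^+ m.+1.
Proof.
case=> _ eqA; rewrite tensor_formE eqA mulr_sumr; apply: eq_bigr => k _.
by rewrite !mxE exprS mulrCA.
Qed.

Theorem theorem4p2 (R : realType) (m n : nat) (hn : (0 < n)%N)
    (A : tensor R m.+1 n) (hA : symmetric_tensor A) :
  strictly_copositive A <->
  (forall N : {set 'I_n}, N != set0 ->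
     ~ (exists lambda : R,
          lambda <= 0 /\ Hpp_eigenvalue (principal_subtensor A N) lambda)).
Proof.
split=> [copA N _ [lambda [lambda0 [v [eigv v0]]]]|noeig].
  have [x [xv xN]] := restrict_vec_surj v.
  have x0 : nonneg_vec x.
    move=> i; have [iN|/xN ->//] := boolP (i \in N).
    have := v0 (enum_rank_in iN i).
    by rewrite -xv mxE enum_rankK_in // => /ltW.
  have xN0 : x != 0.
    apply: contraNneq (proj1 eigv) => x_eq0.
    by rewrite -xv; apply/eqP/rowP => k; rewrite x_eq0 !mxE.
  (* The form equals [lambda] times a nonnegative power sum, so it cannot be positive when
     [lambda <= 0]. *)
  have := copA x x0 xN0; rewrite -(tensor_form_subtensor A xN) xv.
  rewrite (tensor_form_eigen eigv) ltNge mulr_le0_ge0 // sumr_ge0 // => k _.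
  by rewrite exprn_ge0 // ltW.
have [lambda [x [x0 xN0 fx fmin]]] := exists_form_min A hn.
(* A positive minimum gives copositivity directly through [fmin]; a non-positive one must contradict
   [noeig]. *)
have [lambda0|lambda_gt0] := leP lambda 0; last first.
  move=> y y0 yN0; apply: lt_le_trans (fmin y y0).
  by rewrite mulr_gt0 // power_sum_gt0.
pose N := [set i | x 0 i != 0].
have xN i : i \notin N -> x 0 i = 0 by rewrite inE negbK => /eqP.
have xpos i : i \in N -> 0 < x 0 i by rewrite inE lt_neqAle eq_sym x0 => ->.
have [i xi] := rV0Pn _ xN0.
have NN0 : N != set0 by apply/set0Pn; exists i; rewrite inE.
have vpos : pos_vec (restrict_vec N x).
  by move=> k; rewrite mxE xpos // enum_valP.
case: (noeig N NN0); exists lambda; split=> //.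
exists (restrict_vec N x); split=> //; split.
  apply/rV0Pn; have iN : i \in N by rewrite inE.
  by exists (enum_rank_in iN i); rewrite gt_eqF.
apply/rowP => k; rewrite tensor_apply_subtensor // !mxE.
have := stationary_min hA x0 (xpos _ (enum_valP k)) fx fmin.
by rewrite mxE.
Qed.
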